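(* Let $\mathcal{H}$ and $\mathcal{G}$ be real Hilbert spaces, let $B\colon\mathcal{H}\to 2^{\mathcal{H}}$ be a maximally monotone operator, let $M\colon\mathcal{G}\to\mathcal{H}$ be a bounded linear operator such that $M^*BM$ is maximally monotone in $\mathcal{G}$, and let $U\colon\mathcal{G}\to\mathcal{G}$ be a $\mu$-strongly monotone self-adjoint bounded linear operator for some $\mu>0$. Then $UM^*BM$ is maximally monotone in the Hilbert space $(\mathcal{G},\langle\cdot\mid\cdot\rangle_{U^{-1}})$ and the following assertions hold: (i) $\operatorname{ran} M\subset \operatorname{dom}\,(MUM^*+B^{-1})^{-1}$ and $$J_{UM^*BM}=\mathrm{Id}-UM^*(MUM^*+B^{-1})^{-1}M.$$ (ii) $\operatorname{ran}(MUM^* )\subset\operatorname{ran}(MUM^*+B^{-1})$. (iii) The restriction $(MUM^*+B^{-1})|_{\operatorname{ran} M}$ is injective. (iv) Suppose that $\operatorname{ran} M$ is closed. Then $$J_{UM^*BM}=\mathrm{Id}-UM^*J_{B^{-1}}^{MUM^*}(\sqrt{U}M^* )^{\dagger}\sqrt{U}^{-1}.$$ (v) Suppose that $\operatorname{ran} M=\mathcal{H}$. Then $$J_{UM^*BM}=\mathrm{Id}-UM^*J_{(MUM^* )^{-1}B^{-1}}(MUM^* )^{-1}M = P^{U^{-1}}_{\ker M}+UM^*(MUM^* )^{-1}J_{MUM^*B}M.$$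
   Context: For a set-valued operator $A\colon\mathcal{H}\to 2^{\mathcal{H}}$: $\operatorname{dom}A=\{x : Ax\neq\varnothing\}$, $\operatorname{ran}A=\{u : \exists x,\ u\in Ax\}$, $\operatorname{gra}A=\{(x,u): u\in Ax\}$, $A^{-1}u=\{x : u\in Ax\}$, and the resolvent is $J_A=(\mathrm{Id}+A)^{-1}$, where $\mathrm{Id}$ is the identity operator. $A$ is monotone if $\langle x-y\mid u-v\rangle\ge 0$ for all $(x,u),(y,v)\in\operatorname{gra}A$; $\alpha$-strongly monotone ($\alpha>0$) if $\langle x-y\mid u-v\rangle\ge\alpha\|x-y\|^2$ for all such pairs; maximally monotone if it is monotone and every $(x,u)$ satisfying $\langle x-y\mid u-v\rangle\ge 0$ for all $(y,v)\in\operatorname{gra}A$ belongs to $\operatorname{gra}A$. For $D\subset\mathcal{H}$, the restriction $A|_D$ satisfies $A|_Dx=Ax$ for $x\in D$ and $A|_Dx=\varnothing$ otherwise. A set-valued operator $A$ is injective if, for all $x,y\in\mathcal{H}$, $Ax\cap Ay\neq\varnothing$ implies $x=y$. Sums and compositions of set-valued operators are taken setwise (e.g. $(LT)x=\{Ly : y\in Tx\}$, $(TL)x=T(Lx)$ for a single-valued $L$), single-valued maps are viewed as set-valued operators with singleton values, and conversely operators with singleton values are identified with maps. For a strongly monotone self-adjoint bounded linear operator $V$ on a Hilbert space, $\langle x\mid y\rangle_V=\langle x\mid Vy\rangle$ and $\|x\|_V=\sqrt{\langle x\mid x\rangle_V}$. $P^V_C$ denotes the projection onto a nonempty closed convex set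 $C$ with respect to the norm $\|\cdot\|_V$. $\sqrt{U}$ is the positive self-adjoint square root of $U$ and $\sqrt{U}^{-1}$ is its inverse. For an operator $K\colon\mathcal{H}\to\mathcal{H}$, the warped resolvent of $A\colon\mathcal{H}\to2^{\mathcal{H}}$ with kernel $K$ is $J_A^K=(K+A)^{-1}K$ (a possibly set-valued operator). $L^*$ is the adjoint of a bounded linear operator $L$. If $L\colon\mathcal{H}\to\mathcal{G}$ has closed range, its Moore–Penrose inverse $L^\dagger\colon\mathcal{G}\to\mathcal{H}$ maps $y$ to the minimal-norm element of $\{x\in\mathcal{H} : L^*Lx=L^*y\}$. *)

(* Defs.v *)
From HB Require Import structures.
From mathcomp Require Export all_boot all_order all_algebra.
From mathcomp Require Export all_classical all_reals all_analysis.
Import Order.TTheory GRing.Theory Num.Theory.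
Export numFieldNormedType.Exports.

Set Implicit Arguments.
Unset Strict Implicit.
Unset Printing Implicit Defensive.

Local Open Scope classical_set_scope.
Local Open Scope ring_scope.

(* Over a realType R, {dot H for idfun} is the library's type of symmetric
   bilinear positive definite forms on H. *)
HB.mixin Record isHilbert (R : realType) H & CompleteNormedModule R H := {
  inner : {dot H for (@idfun R)};
  norm_inner : forall x : H, `|x| = Num.sqrt (inner x x)
}.

#[short(type="hilbertType")]
HB.structure Definition Hilbert (R : realType) :=
  {H of CompleteNormedModule R H & isHilbert R H}.

(* [ip] makes the vector space E a Hilbert space, for a norm that need not be
   the one E may already carry. *)
Definition hilbert_product (R : realType) (E : lmodType R) (ip : E -> E -> R) :
    Prop :=
  (exists d : {dot E for (@idfun R)}, forall x y, ip x y = d x y) /\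
  (forall u : nat -> E,
     (forall e : R, 0 < e -> exists N : nat, forall m n : nat,
        (N <= m)%N -> (N <= n)%N ->
        Num.sqrt (ip (u m - u n) (u m - u n)) < e) ->
     exists l : E, forall e : R, 0 < e -> exists N : nat, forall n : nat,
       (N <= n)%N -> Num.sqrt (ip (u n - l) (u n - l)) < e).

(* A set-valued operator X -> 2^Y is a function X -> set Y. *)
Section SetValued.
Context {X Y Z : Type}.

Definition op_of (f : X -> Y) : X -> set Y := fun x => [set f x].
Definition opdom (A : X -> set Y) : set X := [set x | A x !=set0].
Definition opran (A : X -> set Y) : set Y := [set u | exists x, A x u].
Definition opinv (A : X -> set Y) : Y -> set X := fun u => [set x | A x u].
Definition opcomp (A : Y -> set Z) (T : X -> set Y) : X -> set Z :=
  fun x => \bigcup_(y in T x) A y.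
Definition oprestrict (A : X -> set Y) (D : set X) : X -> set Y :=
  fun x => [set u | D x /\ A x u].
Definition opinjective (A : X -> set Y) : Prop :=
  forall x y, A x `&` A y !=set0 -> x = y.

End SetValued.

Definition opadd {X : Type} {Y : zmodType} (A B : X -> set Y) : X -> set Y :=
  fun x => [set u + v | u in A x & v in B x].
Definition opsub {X : Type} {Y : zmodType} (A B : X -> set Y) : X -> set Y :=
  fun x => [set u - v | u in A x & v in B x].

(* The map identified with an operator whose values are singletons; it takes
   the junk value 0 where the operator is empty. *)
Definition map_of {X : Type} {Y : zmodType} (A : X -> set Y) : X -> Y :=
  fun x => xget 0 (A x).

Notation "f %:op" := (op_of f) (at level 2, format "f %:op").
Notation "A :o: B" := (opcomp A B) (at level 40, left associativity).
Notation "A :+: B" := (opadd A B) (at level 50, left associativity).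
Notation "A :-: B" := (opsub A B) (at level 50, left associativity).

Definition resolvent {H : zmodType} (A : H -> set H) : H -> set H :=
  opinv ((@idfun H)%:op :+: A).

Definition warped_resolvent {H : zmodType} (K : H -> H) (A : H -> set H) :
    H -> set H :=
  opinv (K%:op :+: A) :o: K%:op.

(* Monotonicity is stated for an explicit product [ip], since it is used below
   for several products on the same space. *)
Section Monotone.
Context {R : realType} {H : lmodType R}.
Implicit Types (ip : H -> H -> R) (A : H -> set H).

Definition monotone_op ip A : Prop :=
  forall x u y v, A x u -> A y v -> 0 <= ip (x - y) (u - v).

Definition strongly_monotone_op (alpha : R) ip A : Prop :=
  forall x u y v, A x u -> A y v ->
    alpha * Num.sqrt (ip (x - y) (x - y)) ^+ 2 <= ip (x - y) (u - v).

Definition maximally_monotone ip A : Prop :=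
  monotone_op ip A /\
  forall x u, (forall y v, A y v -> 0 <= ip (x - y) (u - v)) -> A x u.

End Monotone.

(* The unique vector L^* y with <x | L^* y> = <L x | y> for all x; it exists
   for every bounded linear L by the Riesz representation theorem. *)
Definition adjoint {R : realType} {H G : hilbertType R} (L : H -> G) : G -> H :=
  map_of (fun y => [set z | forall x, inner x z = inner (L x) y]).

(* Values are singletons whenever L is bounded linear with closed range. *)
Definition moore_penrose {R : realType} {H G : hilbertType R} (L : H -> G) :
    G -> set H :=
  fun y => [set x |
    adjoint L (L x) = adjoint L y /\
    forall z, adjoint L (L z) = adjoint L y -> `|x| <= `|z| ].

Section Operators.
Context {R : realType} {G : hilbertType R}.
Implicit Types (U V S : G -> G) (C : set G).

Definition self_adjoint U : Prop := adjoint U = U.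

Definition invmap U : G -> G := map_of (opinv U%:op).

Definition is_positive_sqrt U S : Prop :=
  [/\ linear S, bounded_near S (nbhs (0 : G)), self_adjoint S,
      forall x, 0 <= inner x (S x) & S \o S = U].

(* The positive square root of a positive self-adjoint bounded linear U, which
   exists and is unique. *)
Definition sqrt_op U : G -> G := xget (idfun : G -> G) [set S | is_positive_sqrt U S].

Definition vinner V (x y : G) : R := inner x (V y).
Definition vnorm V (x : G) : R := Num.sqrt (vinner V x x).

(* Values are singletons when C is nonempty, closed and convex. *)
Definition vproj V C : G -> set G :=
  fun x => [set p | C p /\ forall q, C q -> vnorm V (x - p) <= vnorm V (x - q)].

End Operators.

(* Main.v *)
From HB Require Import structures.
Require Import Defs.
From mathcomp Require Import ring lra.

(** The formulas for the resolvent rest on one substitution. A point [y] belongs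
    to the resolvent of [U M^* B M] at [x] when [x = y + U M^* u] for some
    [u \in B (M y)]; eliminating [y] turns the condition on [u] into
    [M x \in M U M^* u + B^-1 u] ([resolvent_dualE]). This is (i), and the other
    formulas are rewritings of it ([resolvent_warped], [resolvent_inv],
    [resolvent_proj]), as soon as the operators that occur in them are known to
    have enough values.

    Those existence results carry the analysis. The operator [U M^* B M] is
    maximally monotone for the product of [U^-1], where the factor [U] cancels
    ([maximally_monotone_comp]), so that Minty's theorem makes its resolvent
    nonempty everywhere; this gives the inclusions of (i) and (ii). Minty's
    theorem ([minty]) is proved by minimizing the Fitzpatrick function plus half
    the squared norm. The same minimization principle ([minimizer_exists])
    yields the Riesz representation ([riesz]), hence adjoints and projections.

    Since [inner h (M U M^* h) >= mu |M^* h|^2], monotonicity of [B] gives the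
    injectivity in (iii). When the range of [M] is closed, the uniform
    boundedness principle shows that [M^*] is bounded below on it
    ([adjoint_bounded_below]); then [M U M^*] is coercive there and maps the
    range onto itself ([MUM_surj_range]). For (iv), the solution in that range of
    [M U M^* w = M (sqrt U z)] is the value of the Moore-Penrose inverse. For
    (v), [K = M U M^*] is bijective, and [x - U M^* K^-1 M x] is the projection
    of [x] on the kernel of [M] because the difference is orthogonal to it in
    the product of [U^-1] ([vproj_ker]).

    The square root of [U] is constructed ([positive_sqrt_exists]) as the limit
    of an iteration that strong monotonicity makes a contraction. *)

Set Implicit Arguments.
Unset Strict Implicit.
Unset Printing Implicit Defensive.

Import Order.TTheory GRing.Theory Num.Theory.

Local Open Scope classical_set_scope.
Local Open Scope ring_scope.

(** * Symmetric positive definite forms *)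

Section DotForm.
Context {R : realType} {E : lmodType R} (d : {dot E for (@idfun R)}).
Implicit Types (x y z : E) (a : R).

Lemma dotC x y : d x y = d y x.
Proof. by rewrite [LHS]hermC /= expr0 mul1r. Qed.

Lemma dotDl x y z : d (x + y) z = d x z + d y z.
Proof. exact: linearDl. Qed.

Lemma dotNl x y : d (- x) y = - d x y.
Proof. exact: linearNl. Qed.

Lemma dotBl x y z : d (x - y) z = d x z - d y z.
Proof. exact: linearBl. Qed.

Lemma dotZl a x y : d (a *: x) y = a * d x y.
Proof. exact: linearZl_LR. Qed.

Lemma dot0l x : d 0 x = 0.
Proof. exact: linear0l. Qed.

Lemma dotDr x y z : d x (y + z) = d x y + d x z.
Proof. by rewrite dotC dotDl !(dotC x). Qed.

Lemma dotNr x y : d x (- y) = - d x y.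
Proof. by rewrite dotC dotNl dotC. Qed.

Lemma dotBr x y z : d x (y - z) = d x y - d x z.
Proof. by rewrite dotC dotBl !(dotC x). Qed.

Lemma dotZr a x y : d x (a *: y) = a * d x y.
Proof. by rewrite dotC dotZl dotC. Qed.

Lemma dot0r x : d x 0 = 0.
Proof. by rewrite dotC dot0l. Qed.

Definition dotE := (dotDl, dotDr, dotBl, dotBr, dotNl, dotNr, dotZl, dotZr).

Lemma dot_ge0 x : 0 <= d x x.
Proof.
have [->|x0] := eqVneq x 0; first by rewrite dot0l.
by rewrite ltW // neq0_dnorm_gt0.
Qed.

Lemma dot_eq0 x : d x x <= 0 -> x = 0.
Proof.
move=> dx; apply/eqP; apply: contraTT dx => x0.
by rewrite -ltNge neq0_dnorm_gt0.
Qed.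

Lemma dot_ext x y : (forall z, d z x = d z y) -> x = y.
Proof.
move=> xy; apply/subr0_eq/dot_eq0.
by rewrite dotBr xy subrr.
Qed.

Lemma cauchy_schwarz x y : `|d x y| <= Num.sqrt (d x x) * Num.sqrt (d y y).
Proof.
rewrite -sqrtrM ?dot_ge0 // -sqrtr_sqr ler_wsqrtr //.
have [->|y0] := eqVneq y 0; first by rewrite !dot0r expr0n mulr0.
have dy : 0 < d y y by rewrite neq0_dnorm_gt0.
have := dot_ge0 (d y y *: x - d x y *: y).
rewrite !dotE (dotC y x) => h.
have : 0 <= d y y * (d x x * d y y - d x y ^+ 2) by apply: le_trans h _; lra.
by rewrite pmulr_rge0 // subr_ge0.
Qed.

End DotForm.

(** Packages a concrete product as a bundled form, which is what the notion of
    Hilbert product asks for. *)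
Lemma dot_of_axioms (R : realType) (E : lmodType R) (ip : E -> E -> R) :
  (forall x y, ip x y = ip y x) ->
  (forall a x y z, ip (a *: x + y) z = a * ip x z + ip y z) ->
  (forall x, x != 0 -> 0 < ip x x) ->
  exists d : {dot E for (@idfun R)}, forall x y, ip x y = d x y.
Proof.
move=> ipC ipP ip_gt0.
have bil : bilinear_for ( *%R : GRing.Scale.law R R)
    (@idfun R \; *%R : GRing.Scale.law R R) ip.
  split=> [z a x y|z a x y]; first exact: ipP.
  by rewrite ipC ipP ![ip z _]ipC.
have her x y : ip x y = (-1) ^+ false * (@idfun R) (ip y x).
  by rewrite expr0 mul1r ipC.
pose b := bilinear_isBilinear.Build R E E R _ _ ip bil.
pose h := isHermitianSesquilinear.Build R E false (@idfun R) ip her.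
pose p := isDotProduct.Build R E ip ip_gt0.
pose D : {dot E for (@idfun R)} := HB.pack ip b h p.
by exists D.
Qed.

(** * Strongly convex minimization and Minty's theorem *)

Lemma half_space_closed (R : realType) (E : lmodType R)
    (d : {dot E for (@idfun R)}) (a x : E) (b t : R) :
  (forall e : R, 0 < e -> exists x' t',
     [/\ d a x' - b <= t', Num.sqrt (d (x' - x) (x' - x)) < e &
         `|t' - t| < e]) ->
  d a x - b <= t.
Proof.
move=> cl; apply/ler_addgt0Pr => e e0.
set K := Num.sqrt (d a a).
have K0 : 0 <= K by rewrite sqrtr_ge0.
have [|x' [t' [le dx dt]]] := cl (e / (K + 1)).
  by rewrite divr_gt0 // ltr_wpDl.
have := cauchy_schwarz d a (x' - x); rewrite -/K dotBr => cs.
have : K * Num.sqrt (d (x' - x) (x' - x)) <= K * (e / (K + 1)).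
  by rewrite ler_wpM2l // ltW.
have : K * (e / (K + 1)) + e / (K + 1) = e by field; lra.
move: cs dt; rewrite ler_norml ltr_norml => /andP[? ?] /andP[? ?]; lra.
Qed.

(** Minimizing [d x x / 2 + t] over a closed convex set [C] of pairs [(x, t)] is
    minimizing a strongly convex function given by its epigraph. Working with
    epigraphs avoids infinite values: the Fitzpatrick function below need not
    be finite. *)
Section Minimization.
Context {R : realType} {E : lmodType R} {d : {dot E for (@idfun R)}}.
Hypothesis d_complete : hilbert_product d.
Variables (C : E -> R -> Prop) (lb : R).
Hypothesis C_convex : forall x s y t (c : R), C x s -> C y t ->
    0 <= c -> c <= 1 ->
  C (x + c *: (y - x)) (s + c * (t - s)).
Hypothesis C_closed : forall x t,
  (forall e : R, 0 < e -> exists x' t',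
     [/\ C x' t', Num.sqrt (d (x' - x) (x' - x)) < e & `|t' - t| < e]) ->
  C x t.
Hypothesis C_neq0 : exists x t, C x t.
Hypothesis C_lb : forall x t, C x t -> lb <= d x x / 2 + t.

Let cost (p : E * R) := d p.1 p.1 / 2 + p.2.
Let costs := cost @` [set p | C p.1 p.2].
Let m := inf costs.

Let costs_inf : has_inf costs.
Proof.
split; first by case: C_neq0 => x [t Cxt]; exists (cost (x, t)); exists (x, t).
by exists lb => _ [[x t] /= Cxt <-]; exact: C_lb.
Qed.

Let m_le x t : C x t -> m <= d x x / 2 + t.
Proof.
by move=> Cxt; apply: ge_inf; [exact: costs_inf.2 | exists (x, t)].
Qed.

(** The parallelogram identity: the cost at the midpoint is the mean of the two
    costs minus [d (x - y) (x - y) / 8], and it is at least [m]. *)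
Let almost_minimizers_close x s y t e : C x s -> C y t ->
  d x x / 2 + s < m + e -> d y y / 2 + t < m + e ->
  d (x - y) (x - y) < 8 * e.
Proof.
move=> Cx Cy lx ly.
have h0 : 0 <= 2^-1 :> R by lra.
have h1 : 2^-1 <= 1 :> R by lra.
have := m_le (C_convex Cx Cy h0 h1).
rewrite !dotE !(dotC d y x); lra.
Qed.

(** Minimizing sequences are Cauchy. The variational inequality is the
    derivative at [0] of the cost along the segment from the minimizer to
    [(x, t)]. *)
Lemma minimizer_exists : exists x0 t0, C x0 t0 /\
  forall x t, C x t -> 0 <= t - t0 + d x0 (x - x0).
Proof.
have Hseq (n : nat) : exists p : E * R, C p.1 p.2 /\ cost p < m + n.+1%:R^-1.
  have n0 : 0 < n.+1%:R^-1 :> R by rewrite invr_gt0.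
  have [_ [p Cp <-] lt] := inf_adherent n0 costs_inf.
  by exists p.
have [u Hu] := choice Hseq.
have small (e : R) : 0 < e -> exists N : nat, forall n, (N <= n)%N ->
    cost (u n) < m + e.
  move=> e0; exists (Num.truncn e^-1) => n Nn.
  apply: (lt_trans (Hu n).2); rewrite ltrD2l invf_plt ?posrE //.
  by apply: (lt_le_trans (truncnS_gt _)); rewrite ler_nat ltnS.
have [x0 Hx0] : exists l : E, forall e : R, 0 < e -> exists N : nat,
    forall n : nat, (N <= n)%N ->
    Num.sqrt (d ((u n).1 - l) ((u n).1 - l)) < e.
  apply: (d_complete.2 (fun n => (u n).1)) => e e0.
  have e8 : 0 < e ^+ 2 / 8 by rewrite divr_gt0 // exprn_gt0.
  have [N HN] := small _ e8; exists N => i j Ni Nj.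
  rewrite -(ger0_norm (ltW e0)) -sqrtr_sqr ltr_sqrt ?exprn_gt0 //.
  have := almost_minimizers_close (Hu i).1 (Hu j).1 (HN _ Ni) (HN _ Nj).
  lra.
(* the value that makes the cost of [(x0, t0)] equal to the infimum *)
pose t0 := m - d x0 x0 / 2.
have C0 : C x0 t0.
  apply: C_closed => e e0.
  set K := Num.sqrt (d x0 x0).
  have K0 : 0 <= K by rewrite sqrtr_ge0.
  pose del := Num.min 1 (e / (4 * (K + 1))).
  have K4 : 0 < 4 * (K + 1) by lra.
  have del0 : 0 < del by rewrite lt_min ltr01 divr_gt0.
  have del1 : del <= 1 by rewrite ge_min lexx.
  have delK : del * (K + 1) <= e / 4.
    have -> : e / 4 = e / (4 * (K + 1)) * (K + 1) by field; lra.
    by rewrite ler_wpM2r ?ge_min ?lexx ?orbT //; lra.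
  have dele : del <= e / 4 by apply: le_trans delK; nra.
  have e2 : 0 < e / 2 by lra.
  have [N1 H1] := Hx0 _ del0; have [N2 H2] := small _ e2.
  pose n := maxn N1 N2.
  have /H1 hx : (N1 <= n)%N by rewrite leq_maxl.
  have /H2 ht : (N2 <= n)%N by rewrite leq_maxr.
  exists (u n).1, (u n).2; split; [exact: (Hu n).1 | by lra |].
  have lo := m_le (Hu n).1.
  have := cauchy_schwarz d ((u n).1 - x0) x0; rewrite -/K.
  have := sqr_sqrtr (dot_ge0 d ((u n).1 - x0)).
  set s := Num.sqrt _ in hx *.
  have s0 : 0 <= s by rewrite sqrtr_ge0.
  have sK : s * K <= del * K by rewrite ler_wpM2r // ltW.
  have ss : s ^+ 2 <= del by nra.
  move: ht lo; rewrite /cost ler_norml ltr_norml /t0.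
  rewrite !dotE !(dotC d x0) => ht lo hs /andP[c1 c2].
  by apply/andP; split; nra.
exists x0, t0; split=> // x t Cxt.
apply/ler_addgt0Pr => e e0.
have := fun c c0 c1 => m_le (C_convex (c := c) C0 Cxt c0 c1).
move: (x - x0) => h step; pose q := d h h.
have q0 : 0 <= q by exact: dot_ge0.
(* a step so short that the second-order term [c * q] is at most [e] *)
pose c := Num.min 1 (e / (q + 1)).
have q1 : 0 < q + 1 by lra.
have c0 : 0 < c by rewrite lt_min ltr01 divr_gt0.
have c1 : c <= 1 by rewrite ge_min lexx.
have cq : c * q <= e.
  apply: (@le_trans _ _ (e / (q + 1) * (q + 1))); last by rewrite divfK //; lra.
  by apply: ler_pM; rewrite ?ge_min ?lexx ?orbT //; lra.
have := step c (ltW c0) c1; rewrite /t0 !dotE (dotC d h x0) -/q => H.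
have : 0 <= c * (t - (m - d x0 x0 / 2) + d x0 h + c * q / 2) by lra.
by rewrite pmulr_rge0 //; lra.
Qed.

End Minimization.

(** Needed because the Fitzpatrick function of an operator on [E] lives on
    [E * E]. *)
Lemma prod_hilbert (R : realType) (E : lmodType R)
    (d : {dot E for (@idfun R)}) : hilbert_product d ->
  exists D : {dot (E * E)%type for (@idfun R)},
    (forall p q, D p q = d p.1 q.1 + d p.2 q.2) /\ hilbert_product D.
Proof.
move=> [_ cpl].
pose ip (p q : E * E) := d p.1 q.1 + d p.2 q.2.
have [|a [x1 x2] [y1 y2] [z1 z2]|x x0|D HD] := dot_of_axioms (ip := ip).
- by move=> p q; rewrite /ip dotC [X in _ + X]dotC.
- by rewrite /ip /= !dotE; ring.
- rewrite lt_neqAle addr_ge0 ?dot_ge0 // andbT eq_sym.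
  apply: contra_neq x0 => h; case: x h => x1 x2; rewrite /ip /= => h.
  have := dot_ge0 d x1; have := dot_ge0 d x2 => h2 h1.
  have -> : x1 = 0 by apply: (dot_eq0 (d := d)); rewrite -h lerDl.
  by have -> : x2 = 0 by apply: (dot_eq0 (d := d)); rewrite -h lerDr.
exists D; split=> [p q|]; first by rewrite -HD.
split; first by exists D.
have Dle1 p : Num.sqrt (d p.1 p.1) <= Num.sqrt (D p p).
  by rewrite -HD ler_wsqrtr // lerDl dot_ge0.
have Dle2 p : Num.sqrt (d p.2 p.2) <= Num.sqrt (D p p).
  by rewrite -HD ler_wsqrtr // lerDr dot_ge0.
have Dle p : Num.sqrt (D p p) <= Num.sqrt (d p.1 p.1) + Num.sqrt (d p.2 p.2).
  have h1 := dot_ge0 d p.1; have h2 := dot_ge0 d p.2.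
  have s1 := sqrtr_ge0 (d p.1 p.1); have s2 := sqrtr_ge0 (d p.2 p.2).
  rewrite -[leRHS]ger0_norm ?addr_ge0 // -sqrtr_sqr ler_wsqrtr //.
  rewrite -HD /ip -{1}(sqr_sqrtr h1) -{1}(sqr_sqrtr h2); nra.
move=> u ucauchy.
have [|l1 H1] := cpl (fun n => (u n).1).
  move=> e /ucauchy[N HN]; exists N => i j Ni Nj.
  exact: le_lt_trans (Dle1 _) (HN _ _ Ni Nj).
have [|l2 H2] := cpl (fun n => (u n).2).
  move=> e /ucauchy[N HN]; exists N => i j Ni Nj.
  exact: le_lt_trans (Dle2 _) (HN _ _ Ni Nj).
exists (l1, l2) => e e0.
have e2 : 0 < e / 2 by lra.
have [N1 {}H1] := H1 _ e2; have [N2 {}H2] := H2 _ e2.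
exists (maxn N1 N2) => n; rewrite geq_max => /andP[n1 n2].
apply: (le_lt_trans (Dle _)); have := H1 _ n1; have := H2 _ n2.
by rewrite /=; lra.
Qed.

(** Minty's theorem. Let [F] be the Fitzpatrick function of [A' = A - z], the
    supremum of the affine functions [(x, u) |-> d y u + d x v - d y v] over the
    graph of [A']. Maximality gives [F (x, u) >= d x u], with equality on the
    graph. Hence [F (x, u) + |x|^2 / 2 + |u|^2 / 2] is nonnegative, and it has a
    minimizer [(x0, u0)]. Its variational inequality, tested on the graph,
    reads [|x0 + u0|^2 <= d (y + u0) (v + x0)]. By maximality [- x0] belongs to
    [A' (- u0)], and testing on that point gives [u0 = - x0], so
    [u0 \in A' (- u0)], that is [z \in - u0 + A (- u0)]. *)
Theorem minty (R : realType) (E : lmodType R) (ip : E -> E -> R)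
    (A : E -> set E) :
  hilbert_product ip -> maximally_monotone ip A ->
  forall z, exists x u, A x u /\ z = x + u.
Proof.
move=> ip_hilbert; have [[d ipd] _] := ip_hilbert.
have {ipd} ipd : ip = d by apply/funext => x; apply/funext => y.
rewrite ipd in ip_hilbert * => -[Amono Amax] z.
have [D [HD D_hilbert]] := prod_hilbert ip_hilbert.
(* the epigraph of the Fitzpatrick function of [A - z] *)
pose C (p : E * E) (t : R) :=
  forall y v, A y v -> D (v - z, y) p - d y (v - z) <= t.
have CA y v : A y v -> C (y, v - z) (d y (v - z)).
  move=> Ayv y' v' Ayv'; have := Amono _ _ _ _ Ayv Ayv'.
  rewrite HD /= !dotE (dotC d v' y) (dotC d z y); lra.
have CF p t : C p t -> d p.1 p.2 <= t.
  case: p => x u Cpt /=; have [|] := pselect (A x (u + z)).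
    move=> /Cpt; rewrite HD /= addrK dotC; lra.
  move=> /(contra_not (Amax _ _))/existsNP[y /existsNP[v /not_implyP[Ayv]]].
  have := Cpt _ _ Ayv.
  move=> + /negP; rewrite -ltNge HD /= !dotE (dotC d v x) (dotC d z x); lra.
have [y0 [v0 Ayv0]] : exists y v, A y v.
  apply: contrapT => A0; apply: (A0); exists 0, 0; apply: Amax => y v Ayv.
  by case: A0; exists y, v.
have [||||p [t0 [Cp opt]]] := minimizer_exists D_hilbert (C := C) (lb := 0).
- move=> x s y t c Cx Cy c0 c1 y' v' Ayv'.
  have := Cx _ _ Ayv'; have := Cy _ _ Ayv'; rewrite !dotE.
  set a := D _ _; set b := D _ _ => h1 h2; nra.
- move=> x t Cx y v Ayv; apply: half_space_closed => e e0.
  by have [x' [t' [C' ? ?]]] := Cx _ e0; exists x', t'; split=> //; exact: C'.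
- by exists (y0, v0 - z), (d y0 (v0 - z)); exact: CA.
- move=> [x u] t /CF /=; rewrite HD /=.
  have := dot_ge0 d (x + u); rewrite !dotE (dotC d u x); lra.
case: p Cp opt => x0 u0 Cp opt.
have key y v : A y v ->
    d (x0 + u0) (x0 + u0) <= d (y + u0) (v - z + x0).
  move=> /CA/opt; have := CF _ _ Cp.
  rewrite HD /= !dotE (dotC d u0 x0) (dotC d y x0); lra.
have A0 : A (- u0) (z - x0).
  apply: Amax => y v Ayv; have := key _ _ Ayv.
  have := dot_ge0 d (x0 + u0).
  move: (d _ _) => s s0 /(le_trans s0).
  rewrite !dotE; lra.
have /dot_eq0/eqP : d (x0 + u0) (x0 + u0) <= 0.
  by have := key _ _ A0; rewrite addNr dot0l.
rewrite addr_eq0 => /eqP x0u0.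
by exists (- u0), (z - x0); split=> //; rewrite x0u0 opprK addrC addrK.
Qed.

(** * Riesz representation, projections, adjoints and coercive equations *)

Lemma bounded_linear_le (R : realType) (E F : normedModType R)
    (f : {linear E -> F}) :
  bounded_near f (nbhs (0 : E)) ->
  exists2 k : R, 0 < k & forall x, `|f x| <= k * `|x|.
Proof. by move=> /linear_boundedP/pinfty_ex_gt0[k k0 fk]; exists k. Qed.

Section HilbertSpace.
Context {R : realType} {H : hilbertType R}.
Implicit Types (x y z : H) (V : set H).

Lemma norm_sqr x : `|x| ^+ 2 = inner x x.
Proof. by rewrite norm_inner sqr_sqrtr // dot_ge0. Qed.

Lemma inner_le_norm x y : `|inner x y| <= `|x| * `|y|.
Proof. by rewrite !norm_inner cauchy_schwarz. Qed.

Lemma inner_hilbert : hilbert_product (@inner R H).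
Proof.
split; first by exists inner.
move=> u ucauchy.
have ucvg : cvgn u.
  apply/cauchy_cvgP/cauchy_exP => e e0; have [N HN] := ucauchy e e0.
  exists (u N), N => // n /= Nn; rewrite -ball_normE /ball_ /= norm_inner.
  exact: HN.
exists (lim (u @ \oo)) => e e0.
have /cvgrPdist_lt/(_ e e0)[N _ HN] := ucvg.
by exists N => n Nn; rewrite -norm_inner distrC; exact: HN.
Qed.

(** A predicate rather than a bundled subspace: closed ranges inherit the norm
    of the ambient space, and no Hilbert structure has to be put on them. *)
Definition linear_subspace V :=
  V 0 /\ forall (a : R) x y, V x -> V y -> V (a *: x + y).

Lemma linear_subspaceB V x y : linear_subspace V -> V x -> V y -> V (x - y).
Proof. by move=> [_ Vl] Vx Vy; rewrite addrC -scaleN1r; exact: Vl. Qed.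

Lemma linear_subspaceZ V (a : R) x : linear_subspace V -> V x -> V (a *: x).
Proof. by move=> [V0 Vl] Vx; rewrite -[_ *: _]addr0; exact: Vl. Qed.

Lemma linear_subspaceT : linear_subspace [set: H]. Proof. by []. Qed.

(** Riesz representation on a closed subspace, with a representative in it: the
    minimizer of [|x|^2 / 2 - f x]. The whole space gives adjoints; the form
    [inner x] gives the orthogonal projection of [x]. *)
Lemma riesz V (f : H -> R) (k : R) : linear_subspace V -> closed V ->
  (forall a x y, f (a *: x + y) = a * f x + f y) ->
  (forall x, `|f x| <= k * `|x|) ->
  exists2 z, V z & forall v, V v -> inner z v = f v.
Proof.
move=> Vs Vc fl fk.
have fB x y : f (x - y) = f x - f y by rewrite addrC -scaleN1r fl; ring.
have f0 : f 0 = 0 by rewrite -(subrr 0) fB subrr.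
have fZ a x : f (a *: x) = a * f x by rewrite -[_ *: _]addr0 fl f0 addr0.
pose C x t := V x /\ - f x <= t.
have [||||z [t [[Vz fz] opt]]] := minimizer_exists inner_hilbert (C := C)
    (lb := - k ^+ 2 / 2).
- move=> x s y t c [Vx fx] [Vy fy] c0 c1; split.
    by rewrite addrC; apply: Vs.2 => //; exact: linear_subspaceB.
  by rewrite addrC fl fB; nra.
- move=> x t cl; split.
    rewrite (closure_id V).1 // => B /nbhs_ballP[e /= e0 eB].
    have [y [s [[Vy _]]]] := cl e e0; rewrite -norm_inner => ye _.
    by exists y; split=> //; apply: eB; rewrite -ball_normE /= distrC.
  apply/ler_addgt0Pr => e e0.
  pose c := `|k| + 1.
  have c0 : 0 < c by rewrite ltr_wpDl.
  have [|y [s [[_ fy]]]] := cl (e / c); first by rewrite divr_gt0.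
  rewrite -norm_inner => yx st.
  have : k * `|y - x| <= `|k| * (e / c).
    by rewrite (le_trans (ler_wpM2r _ (ler_norm k))) // ler_wpM2l // ltW.
  have : `|k| * (e / c) + e / c = e by rewrite /c; field; rewrite gt_eqF.
  move: (fk (y - x)) st; rewrite fB ler_norml ltr_norml.
  by move=> /andP[_ ?] /andP[? ?]; lra.
- by exists 0, 0; split; [exact: Vs.1 | rewrite f0 oppr0].
- move=> x t [_ fx]; rewrite -norm_sqr.
  have := sqr_ge0 (`|x| - k); have := fk x; rewrite ler_norml => /andP[_].
  rewrite sqrrB; lra.
have le v : V v -> f v <= inner z v.
  move=> Vv.
  have Czv : C (z + v) (- f (z + v)).
    by split=> //; rewrite -[z]scale1r; exact: Vs.2.
  have := opt _ _ Czv; have -> : f (z + v) = f z + f v.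
    by rewrite -[z]scale1r fl mul1r scale1r.
  by rewrite (addrC z v) addrK; lra.
exists z => // v Vv; apply/eqP; rewrite eq_le le // andbT.
have := le _ (linear_subspaceZ (-1) Vs Vv); rewrite fZ dotZr; lra.
Qed.

Lemma orthogonal_projection V x : linear_subspace V -> closed V ->
  exists2 p, V p & forall v, V v -> inner p v = inner x v.
Proof.
move=> Vs Vc; apply: (@riesz V (inner x) `|x|) => //.
  by move=> a y z; rewrite !dotE.
exact: inner_le_norm.
Qed.

(** With [l >= k] and [t = alpha / l^2],
    [|x - t T x|^2 <= (1 - 2 t alpha + t^2 l^2) |x|^2], and the factor is
    [1 - alpha^2 / l^2]. *)
Lemma relaxation_contraction V (T : H -> H) (k alpha : R) :
  0 < alpha -> (forall x, V x -> `|T x| <= k * `|x|) ->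
  (forall x, V x -> alpha * `|x| ^+ 2 <= inner x (T x)) ->
  exists t q : R, [/\ 0 < t, 0 <= q, q < 1 &
    forall x, V x -> `|x - t *: T x| <= q * `|x|].
Proof.
move=> a0 Tk Ta.
(* also above [alpha], which makes [1 - alpha^2 / l^2] nonnegative *)
pose l := `|k| + alpha.
have al : alpha <= l by rewrite lerDr.
have kl : k <= l by apply: (le_trans (ler_norm k)); rewrite lerDl ltW.
have l0 : 0 < l by lra.
pose r := alpha / l.
have r0 : 0 < r by rewrite divr_gt0.
have r1 : r <= 1 by rewrite ler_pdivrMr // mul1r.
have rl : r * l = alpha by rewrite divfK // gt_eqF.
exists (r / l), (Num.sqrt (1 - r ^+ 2)).
have r2 : 0 <= 1 - r ^+ 2 by nra.
split=> [|||x Vx].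
- by rewrite divr_gt0.
- exact: sqrtr_ge0.
- by rewrite -[ltRHS]sqrtr1 ltr_sqrt ?ltr01 //; nra.
- rewrite -[leRHS]ger0_norm ?mulr_ge0 ?sqrtr_ge0 // -sqrtr_sqr norm_inner.
  rewrite ler_wsqrtr // exprMn sqr_sqrtr // !dotE -norm_sqr -norm_sqr.
  rewrite (dotC _ (T x)).
  have := Ta x Vx; have := Tk x Vx.
  have := normr_ge0 x; have := normr_ge0 (T x).
  move: (inner _ _) => p; move: `|x| `|T x| => n m m0 n0 mk pa.
  have mn : m ^+ 2 <= (l * n) ^+ 2.
    rewrite ler_sqr ?nnegrE ?mulr_ge0 ?(ltW l0) //.
    by apply: le_trans mk _; rewrite ler_wpM2r.
  have tl : r / l * l = r by rewrite divfK // gt_eqF.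
  have t0 : 0 <= r / l by rewrite divr_ge0 // ltW.
  move: (r / l) tl t0 => t tl t0.
  have h1 : t * (alpha * n ^+ 2) <= t * p by rewrite ler_wpM2l.
  have h2 : t ^+ 2 * m ^+ 2 <= t ^+ 2 * (l * n) ^+ 2.
    by rewrite ler_wpM2l // sqr_ge0.
  have e1 : t * (alpha * n ^+ 2) = r ^+ 2 * n ^+ 2.
    by rewrite -rl -tl; ring.
  have e2 : t ^+ 2 * (l * n) ^+ 2 = r ^+ 2 * n ^+ 2 by rewrite -tl; ring.
  have : n ^+ 2 - t * p - (t * p - t * (t * m ^+ 2)) <= (1 - r ^+ 2) * n ^+ 2.
    nra.
  lra.
Qed.

(** The solution is the fixed point of the relaxation
    [x |-> x - t (T x - b)], a contraction of [V]. *)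
Lemma lax_milgram V (T : H -> H) (k alpha : R) : linear_subspace V -> closed V ->
  linear T -> 0 < alpha -> (forall x, V x -> V (T x)) ->
  (forall x, V x -> `|T x| <= k * `|x|) ->
  (forall x, V x -> alpha * `|x| ^+ 2 <= inner x (T x)) ->
  forall b, V b -> exists2 x, V x & T x = b.
Proof.
move=> Vs Vc Tl a0 TV Tk Ta b Vb.
have [t [q [t0 q0 q1 Tq]]] := relaxation_contraction a0 Tk Ta.
pose f x := x - t *: (T x - b).
have fV : set_fun V V f.
  move=> x Vx; apply: linear_subspaceB => //; apply: linear_subspaceZ => //.
  by apply: linear_subspaceB => //; exact: TV.
pose F : {fun V >-> V} := HB.pack f (isFun.Build _ _ _ _ f fV).
have [||x Vx /esym/eqP] := @banach_fixed_point _ _ V F _ Vc.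
- exists (NngNum q0); split=> //= -[x y] [/= Vx Vy].
  have -> : f x - f y = (x - y) - t *: T (x - y).
    rewrite (zmod_morphism_linear Tl) /f !scalerBr.
    rewrite -!addrA; congr (_ + _); rewrite !opprD !opprK.
    rewrite !addrA addrAC; congr (_ + _); rewrite addrAC.
    by rewrite addrC !addrA addrK addrC.
  by apply: Tq; exact: linear_subspaceB.
- by exists 0; exact: Vs.1.
rewrite subr_eq -subr_eq0 opprD addrA subrr add0r oppr_eq0 scaler_eq0.
by rewrite gt_eqF //= subr_eq0 => /eqP; exists x.
Qed.

End HilbertSpace.

Section Adjoint.
Context {R : realType} {G H : hilbertType R}.

Lemma adjoint_unique (L : G -> H) (N : H -> G) :
  (forall x y, inner x (N y) = inner (L x) y) -> adjoint L = N.
Proof.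
move=> LN; apply/funext => y; apply: (dot_ext (d := inner)) => z.
rewrite LN /adjoint /map_of; case: xgetP => [w _ -> //|/(_ (N y))[]].
by move=> x; exact: LN.
Qed.

Section BoundedLinear.
Variable L : {linear G -> H}.
Hypothesis L_bounded : bounded_near L (nbhs (0 : G)).

Lemma adjointE x y : inner x (adjoint L y) = inner (L x) y.
Proof.
have [k k0 Lk] := bounded_linear_le L_bounded.
have [||a u v|u|z _ Hz] := @riesz R G setT (fun u => inner (L u) y)
  (k * `|y|).
- exact: linear_subspaceT.
- exact: closedT.
- by rewrite linearP !dotE.
- rewrite mulrAC (le_trans (inner_le_norm _ _)) // ler_wpM2r //.
rewrite /adjoint /map_of; case: xgetP => [w _ -> //|/(_ z)[]].
by move=> u; rewrite dotC; exact: Hz.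
Qed.

Lemma adjoint_linear : linear (adjoint L).
Proof.
move=> a u v; apply: (dot_ext (d := inner)) => z.
by rewrite adjointE !dotE !adjointE.
Qed.

Lemma adjoint_le : exists2 k, 0 < k & forall y, `|adjoint L y| <= k * `|y|.
Proof.
have [k k0 Lk] := bounded_linear_le L_bounded; exists k => // y.
have [->|z0] := eqVneq (adjoint L y) 0; first by rewrite normr0 mulr_ge0 // ltW.
move: z0; rewrite -normr_gt0 => z0.
rewrite -(ler_pM2l z0) -expr2 norm_sqr adjointE.
rewrite (le_trans (ler_norm _)) // (le_trans (inner_le_norm _ _)) //.
by rewrite mulrCA mulrA ler_wpM2r.
Qed.

End BoundedLinear.
End Adjoint.

(** * Operators with closed range *)

Section ClosedRange.
Context {R : realType} {G H : hilbertType R} (L : {linear G -> H}).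
Hypothesis L_bounded : bounded_near L (nbhs (0 : G)).

Lemma linear_subspace_range : linear_subspace (range L).
Proof.
split; first by exists 0 => //; rewrite linear0.
by move=> a _ _ [x _ <-] [y _ <-]; exists (a *: x + y) => //; rewrite linearP.
Qed.

Lemma adjoint_inj_range h : range L h -> adjoint L h = 0 -> h = 0.
Proof.
move=> [x _ <-] Lx0; apply: (dot_eq0 (d := inner)).
by rewrite -(adjointE L_bounded) Lx0 dot0r.
Qed.

(** The part of the closed range theorem that matters here. The vectors [h] of
    the range with [|L^* h| <= 1], seen as functionals, are pointwise bounded:
    at [g], only the projection [L x] of [g] on the range counts, and
    [inner h (L x) = inner (L^* h) x]. The uniform boundedness principle makes
    them bounded. *)
Lemma adjoint_bounded_below : closed (range L) ->
  exists2 K : R, 0 < K & forall h, range L h -> `|h| <= K * `|adjoint L h|.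
Proof.
move=> Lc.
pose F : set (H -> R) :=
  [set f | exists h, [/\ range L h, `|adjoint L h| <= 1 & f = inner h]].
have [|g|K HK] := @Banach_Steinhauss R H R F _ _ 1.
- move=> f [h [_ _ ->]]; split.
    move=> r; exists (`|h| * r) => x xr.
    by rewrite (le_trans (inner_le_norm _ _)) // ler_wpM2l.
  by move=> a u v; rewrite !dotE.
- have [_ [x _ <-] Hx] := orthogonal_projection g linear_subspace_range Lc.
  exists `|x| => f [h [Lh h1 ->]].
  rewrite dotC -Hx // -(adjointE L_bounded).
  rewrite (le_trans (inner_le_norm _ _)) //.
  by rewrite -[leRHS]mulr1 ler_wpM2l.
have bound h : range L h -> `|adjoint L h| <= 1 -> `|h| <= K.
  move=> Lh h1; have {}HK x : `|x| <= 1 -> `|inner h x| <= K.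
    by apply: HK; exists h.
  have [->|] := eqVneq h 0.
    by have := HK 0; rewrite dot0r !normr0; apply; exact: ler01.
  rewrite -normr_gt0 => h0; have := HK (`|h|^-1 *: h).
  rewrite normrZ normfV normr_id mulVf ?gt_eqF // => /(_ (lexx _)).
  by rewrite dotZr -norm_sqr expr2 mulrA mulVf ?gt_eqF // mul1r normr_id.
exists (`|K| + 1); first by rewrite ltr_wpDl.
move=> h Lh; have [L0|L0] := eqVneq (adjoint L h) 0.
  by rewrite (adjoint_inj_range Lh L0) normr0 mulr_ge0 // addr_ge0.
move: L0; rewrite -normr_gt0 => L0.
set n := `|adjoint L h| in L0 *.
have := bound (n^-1 *: h) (linear_subspaceZ _ linear_subspace_range Lh).
have -> : adjoint L (n^-1 *: h) = n^-1 *: adjoint L h.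
  by rewrite (scalable_linear (adjoint_linear L_bounded)).
rewrite !normrZ gtr0_norm ?invr_gt0 // -/n mulVf ?gt_eqF // => /(_ (lexx _)).
rewrite mulrC ler_pdivrMr // => /le_trans; apply.
by rewrite ler_wpM2r ?(ltW L0) // (le_trans (ler_norm K)) // lerDl.
Qed.

End ClosedRange.

(** * Square roots of strongly monotone operators *)

Lemma inner_cvg (R : realType) (H : hilbertType R) (u : nat -> H) (l x : H) :
  u n @[n --> \oo] --> l -> inner x (u n) @[n --> \oo] --> inner x l.
Proof.
move=> ul; apply/cvgrPdist_lt => e e0.
have c0 : 0 < `|x| + 1 by rewrite ltr_wpDl.
have /cvgrPdist_lt/(_ (e / (`|x| + 1))) := ul.
rewrite divr_gt0 // => /(_ isT); apply: filterS => n.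
rewrite ltr_pdivlMr // => un.
rewrite -dotBr (le_lt_trans (inner_le_norm _ _)) //; have := normr_ge0 (l - u n).
nra.
Qed.

(** Square roots are computed by iteration: [(1 - Y)^2 = 1 - D] amounts to
    [Y = (D + Y^2) / 2]. When [|D| <= q < 1], the map
    [Y |-> (D + Y^2) / 2] preserves the operators of norm at most [q] and is
    [q]-Lipschitz on them, since [Y^2 - Z^2 = Y (Y - Z) + (Y - Z) Z]. The limit
    is taken pointwise, so that no norm on operators is needed. *)
Section SquareRoot.
Context {R : realType} {G : hilbertType R} (D : {linear G -> G}) (q : R).
Hypothesis q_ge0 : 0 <= q.
Hypothesis q_lt1 : q < 1.
Hypothesis D_le : forall x, `|D x| <= q * `|x|.
Hypothesis D_sym : forall x y, inner x (D y) = inner (D x) y.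

Fixpoint sqrt_iter (n : nat) : G -> G :=
  if n is n'.+1 then fun x => 2^-1 *: (D x + sqrt_iter n' (sqrt_iter n' x))
  else fun=> 0.

Let Y := sqrt_iter.

Let Y_linear n : linear (Y n).
Proof.
elim: n => [|n IH] a u v /=; first by rewrite scaler0 addr0.
by rewrite linearP !IH addrACA -scalerDr [LHS]scalerDr !scalerA (mulrC a).
Qed.

Let YB n x y : Y n (x - y) = Y n x - Y n y.
Proof. exact: (zmod_morphism_linear (Y_linear n)). Qed.

Let Y_sym n x y : inner x (Y n y) = inner (Y n x) y.
Proof.
elim: n x y => [|n IH] x y /=; first by rewrite dot0r dot0l.
by rewrite !dotE D_sym !IH.
Qed.

Let Y_le n x : `|Y n x| <= q * `|x|.
Proof.
elim: n x => [|n IH] x /=; first by rewrite normr0 mulr_ge0.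
rewrite normrZ gtr0_norm ?invr_gt0 ?ltr0n //.
have := ler_normD (D x) (Y n (Y n x)); have := IH (Y n x); have := IH x.
have := D_le x; have := normr_ge0 x; have := normr_ge0 (Y n x).
have := q_ge0; have := q_lt1.
move=> h1 h2 h3 h4 h5 h6 h7 h8.
have : q * `|Y n x| <= 1 * `|Y n x| by rewrite ler_wpM2r // ltW.
by rewrite ler_pdivrMl ?ltr0n //; lra.
Qed.

Let Y_step n x : `|Y n.+1 x - Y n x| <= q ^+ n * (q * `|x|).
Proof.
elim: n x => [|n IH] x; first by rewrite expr0 mul1r subr0 Y_le.
have -> : Y n.+2 x - Y n.+1 x = 2^-1 *:
   (Y n.+1 (Y n.+1 x - Y n x) + (Y n.+1 (Y n x) - Y n (Y n x))).
  rewrite YB addrA subrK /= -scalerBr; congr (_ *: _).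
  by rewrite opprD addrACA subrr add0r.
rewrite normrZ gtr0_norm ?invr_gt0 ?ltr0n // ler_pdivrMl ?ltr0n //.
apply: (le_trans (ler_normD _ _)).
have h1 : `|Y n.+1 (Y n.+1 x - Y n x)| <= q * (q ^+ n * (q * `|x|)).
  by apply: (le_trans (Y_le _ _)); rewrite ler_wpM2l.
have h2 : `|Y n.+1 (Y n x) - Y n (Y n x)| <= q ^+ n * (q * (q * `|x|)).
  apply: (le_trans (IH _)); by rewrite !ler_wpM2l ?exprn_ge0 ?Y_le.
rewrite exprS; lra.
Qed.

Let Y_cvg x : cvgn (Y ^~ x).
Proof.
have -> : Y ^~ x = series (fun n => Y n.+1 x - Y n x).
  apply/funext => n; rewrite /series /= telescope_sumr // subr0 //.
apply: normed_cvg; apply: (series_le_cvg (v_ := geometric (q * `|x|) q)).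
- by move=> n /=.
- by move=> n /=; rewrite mulr_ge0 ?exprn_ge0 // mulr_ge0.
- by move=> n /=; rewrite mulrC Y_step.
- by apply: is_cvg_geometric_series; rewrite ger0_norm.
Qed.

Let Yl x : G := lim (Y n x @[n --> \oo]).

Let Yl_cvg x : Y n x @[n --> \oo] --> Yl x.
Proof. exact: Y_cvg. Qed.

Let Yl_linear : linear Yl.
Proof.
move=> a x y; apply/cvg_lim; first exact: norm_hausdorff.
have -> : Y ^~ (a *: x + y) = (fun n => a *: Y n x + Y n y).
  by apply/funext => n; rewrite Y_linear.
by apply: cvgD => //; exact: cvgZl_tmp.
Qed.

Let Yl_le x : `|Yl x| <= q * `|x|.
Proof.
by apply: (cvgr_to_le (cvg_norm (@Yl_cvg x))); exact: nearW.
Qed.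

Let Yl_sym x y : inner x (Yl y) = inner (Yl x) y.
Proof.
have h1 := inner_cvg (x := x) (@Yl_cvg y).
have h2 := inner_cvg (x := y) (@Yl_cvg x).
rewrite (dotC _ _ y); apply: (cvg_unique _ h1); first exact: norm_hausdorff.
suff -> : (fun n => inner x (Y n y)) = (fun n => inner y (Y n x)) by [].
by apply/funext => n; rewrite Y_sym dotC.
Qed.

Let Yl_fixed x : Yl x = 2^-1 *: (D x + Yl (Yl x)).
Proof.
have h1 : Y n.+1 x @[n --> \oo] --> Yl x by rewrite (cvg_shiftS (Y ^~ x)).
apply: (cvg_unique _ h1); first exact: norm_hausdorff.
apply: cvgZl_tmp; apply: cvgD; first exact: cvg_cst.
have -> : (fun n => Y n (Y n x)) = (fun n => Y n (Yl x) - Y n (Yl x - Y n x)).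
  by apply/funext => n; rewrite YB opprB addrC subrK.
rewrite -[Yl (Yl x)]subr0; apply: cvgB => //.
apply/cvgrPdist_lt => e e0.
have /cvgrPdist_lt/(_ e e0) := @Yl_cvg x; apply: filterS => n h.
rewrite sub0r normrN; apply: le_lt_trans h; apply: (le_trans (Y_le _ _)).
by rewrite ler_piMl // ltW.
Qed.

Lemma quadratic_fixpoint_exists : exists Z : G -> G, [/\ linear Z,
  forall x, `|Z x| <= q * `|x|, forall x y, inner x (Z y) = inner (Z x) y &
  forall x, Z x = 2^-1 *: (D x + Z (Z x))].
Proof. by exists Yl. Qed.

End SquareRoot.

(** Strong monotonicity makes [D = 1 - t U] a strict contraction for a small
    [t > 0], so that the iteration converges geometrically. If [Z] is its limit,
    then [(1 - Z) / sqrt t] is a square root of [U]; it is positive because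
    [|Z| < 1]. *)
Theorem positive_sqrt_exists (R : realType) (G : hilbertType R)
    (U : {linear G -> G}) (mu : R) :
  bounded_near U (nbhs (0 : G)) ->
  (forall x y, inner x (U y) = inner (U x) y) -> 0 < mu ->
  (forall x, mu * `|x| ^+ 2 <= inner x (U x)) ->
  exists S, is_positive_sqrt U S.
Proof.
move=> /bounded_linear_le[k k0 Uk] Us mu0 Umu.
have [t [q [t0 q0 q1 Dq]]] := relaxation_contraction (V := setT) mu0
  (fun x _ => Uk x) (fun x _ => Umu x).
pose f x := x - t *: U x.
have fl : linear f.
  move=> a x y; rewrite /f linearP !scalerBr !scalerDr !scalerA (mulrC a).
  by rewrite opprD addrACA.
pose D : {linear G -> G} := HB.pack f (GRing.isLinear.Build _ _ _ _ f fl).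
have fs x y : inner x (D y) = inner (D x) y by rewrite /= /f !dotE Us.
have [Z [Zl Zq Zs Ze]] := quadratic_fixpoint_exists (D := D) q0 q1
  (fun x => Dq x I) fs.
pose r := (Num.sqrt t)^-1.
have r0 : 0 < r by rewrite invr_gt0 sqrtr_gt0.
pose S x := r *: (x - Z x).
have Sl : linear S.
  move=> a x y; rewrite /S Zl !scalerBr !scalerDr !scalerA (mulrC a).
  by rewrite opprD addrACA.
exists S; split=> //.
- pose S' : {linear G -> G} := HB.pack S (GRing.isLinear.Build _ _ _ _ S Sl).
  apply/(bounded_funP S') => b; exists (r * (b + b)) => x xb /=.
  rewrite /S normrZ gtr0_norm // ler_wpM2l ?(ltW r0) //.
  rewrite (le_trans (ler_normB _ _)) // lerD //.
  by rewrite (le_trans (Zq x)) // (le_trans _ xb) // ler_piMl // ltW.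
- by apply: adjoint_unique => x y; rewrite /S !dotE Zs.
- move=> x; rewrite /S dotZr mulr_ge0 ?(ltW r0) // dotBr -norm_sqr subr_ge0.
  rewrite (le_trans (ler_norm _)) // (le_trans (inner_le_norm _ _)) //.
  by rewrite expr2 ler_wpM2l // (le_trans (Zq x)) // ler_piMl // ltW.
- apply/funext => x /=; rewrite /S (scalable_linear Zl).
  rewrite (zmod_morphism_linear Zl) -scalerBr scalerA.
  have -> : r * r = t^-1 by rewrite /r -invfM -expr2 sqr_sqrtr // ltW.
  have h : D x + Z (Z x) = Z x + Z x.
    have two : 2^-1 + 2^-1 = 1 :> R by field.
    by rewrite -[LHS]scale1r -two scalerDl -Ze.
  have -> : x - Z x - (Z x - Z (Z x)) = t *: U x.
    have -> : t *: U x = x - D x by rewrite /= /f opprB addrC subrK.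
    have -> : D x = Z x + Z x - Z (Z x) by rewrite -h addrK.
    by rewrite opprB -addrA opprB opprD (addrA (Z (Z x))) (addrC (- Z x)).
  by rewrite scalerA mulVf ?scale1r // gt_eqF.
Qed.

(** * The product defined by the inverse of U *)

(** The norm of [V] is equivalent to the original one, so completeness
    carries over. *)
Lemma vinner_hilbert (R : realType) (G : hilbertType R) (V : G -> G)
    (a b : R) :
  linear V -> (forall x y, inner x (V y) = inner (V x) y) -> 0 < a ->
  (forall x, a * `|x| ^+ 2 <= inner x (V x)) ->
  (forall x, inner x (V x) <= b * `|x| ^+ 2) ->
  hilbert_product (vinner V).
Proof.
move=> Vl Vs a0 Va Vb; split.
  apply: dot_of_axioms => [x y|c x y z|x x0]; rewrite /vinner.
  - by rewrite Vs dotC.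
  - by rewrite !dotE.
  - by rewrite (lt_le_trans _ (Va x)) // mulr_gt0 // exprn_gt0 // normr_gt0.
pose c := `|b| + 1.
have c0 : 0 < c by rewrite ltr_wpDl.
have lower x : Num.sqrt a * `|x| <= Num.sqrt (vinner V x x).
  rewrite -[X in _ * X]ger0_norm // -sqrtr_sqr -sqrtrM ?(ltW a0) //.
  exact: ler_wsqrtr.
have upper x : Num.sqrt (vinner V x x) <= Num.sqrt c * `|x|.
  rewrite -[X in _ * X]ger0_norm // -sqrtr_sqr -sqrtrM ?(ltW c0) //.
  rewrite ler_wsqrtr // (le_trans (Vb x)) // ler_wpM2r ?sqr_ge0 //.
  by rewrite (le_trans (ler_norm b)) // lerDl.
have sa : 0 < Num.sqrt a by rewrite sqrtr_gt0.
have sc : 0 < Num.sqrt c by rewrite sqrtr_gt0.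
move=> u ucauchy; have [e e0|l Hl] := (@inner_hilbert R G).2 u.
  have [|N HN] := ucauchy (Num.sqrt a * e); first by rewrite mulr_gt0.
  exists N => m n Nm Nn; rewrite -norm_inner -(ltr_pM2l sa).
  exact: le_lt_trans (lower _) (HN _ _ Nm Nn).
exists l => e e0; have [|N HN] := Hl (e / Num.sqrt c).
  by rewrite divr_gt0.
exists N => n Nn; apply: (le_lt_trans (upper _)).
by rewrite mulrC -ltr_pdivlMr // norm_inner; exact: HN.
Qed.

Section StronglyMonotone.
Context {R : realType} {G : hilbertType R} (U : {linear G -> G}) (mu : R).
Hypothesis U_bounded : bounded_near U (nbhs (0 : G)).
Hypothesis U_self_adjoint : self_adjoint U.
Hypothesis mu_gt0 : 0 < mu.
Hypothesis U_strong : strongly_monotone_op mu inner U%:op.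

Lemma self_adjointE x y : inner x (U y) = inner (U x) y.
Proof. by rewrite -(adjointE U_bounded) U_self_adjoint. Qed.

Lemma strongly_monotone_coercive x : mu * `|x| ^+ 2 <= inner x (U x).
Proof.
have := @U_strong x (U x) 0 (U 0) erefl erefl.
by rewrite linear0 !subr0 norm_inner.
Qed.

Lemma strongly_monotone_surj y : exists x, U x = y.
Proof.
have [k k0 Uk] := bounded_linear_le U_bounded.
have [] := @lax_milgram R G setT U k mu linear_subspaceT closedT _ mu_gt0
  (fun _ _ => I) (fun x _ => Uk x) (fun x _ => strongly_monotone_coercive x) y I.
  by move=> a u v; rewrite linearP.
by move=> x _ <-; exists x.
Qed.

Lemma strongly_monotone_inj : injective U.
Proof.
move=> x y xy; apply/subr0_eq/(dot_eq0 (d := inner)).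
have := strongly_monotone_coercive (x - y); rewrite linearB xy subrr dot0r norm_sqr.
by rewrite pmulr_rle0.
Qed.

Lemma invmapK y : U (invmap U y) = y.
Proof.
rewrite /invmap /map_of; case: xgetP => [x _ -> //|].
by have [x Ux] := strongly_monotone_surj y => /(_ x)[]; rewrite /opinv /op_of /= Ux.
Qed.

Lemma invmap_mapK x : invmap U (U x) = x.
Proof. by apply: strongly_monotone_inj; rewrite invmapK. Qed.

Lemma invmap_hilbert : hilbert_product (vinner (invmap U)).
Proof.
have [k k0 Uk] := bounded_linear_le U_bounded.
have mu_le x : mu * `|x| <= `|U x|.
  have [->|] := eqVneq x 0; first by rewrite normr0 mulr0.
  rewrite -normr_gt0 => x0; rewrite -(ler_pM2l x0).
  have := strongly_monotone_coercive x; have := inner_le_norm x (U x).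
  have := ler_norm (inner x (U x)); lra.
apply: (@vinner_hilbert _ _ _ (mu / k ^+ 2) (mu^-1)).
- by move=> a x y; apply: strongly_monotone_inj; rewrite linearP !invmapK.
- by move=> x y; rewrite -{1}(invmapK x) -self_adjointE invmapK.
- by rewrite divr_gt0 // exprn_gt0.
- move=> x; rewrite -{1 2}(invmapK x); set z := invmap U x.
  rewrite (dotC _ _ z) (le_trans _ (strongly_monotone_coercive z)) //.
  rewrite mulrAC ler_pdivrMr ?exprn_gt0 // -mulrA ler_wpM2l ?(ltW mu_gt0) //.
  by rewrite mulrC -exprMn ler_sqr ?nnegrE ?mulr_ge0 ?(ltW k0).
- move=> x; rewrite -{1 3}(invmapK x); set z := invmap U x.
  rewrite (dotC _ _ z) (le_trans (ler_norm _)) // (le_trans (inner_le_norm _ _)) //.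
  rewrite ler_pdivlMl // expr2 mulrA ler_wpM2r //; exact: mu_le.
Qed.

(** In the product of [U^-1] the factor [U] cancels:
    [vinner U^-1 (x - y) (U u - U v) = inner (x - y) (u - v)]. *)
Lemma maximally_monotone_comp (A : G -> set G) : maximally_monotone inner A ->
  maximally_monotone (vinner (invmap U)) (U%:op :o: A).
Proof.
move=> [Amono Amax].
have diff (x y u v : G) :
    vinner (invmap U) (x - y) (U u - U v) = inner (x - y) (u - v).
  by rewrite /vinner -linearB invmap_mapK.
split.
  by move=> x _ y _ [u Au ->] [v Av ->]; rewrite diff; exact: Amono.
move=> x u xu; exists (invmap U u); last by rewrite /op_of /= invmapK.
apply: Amax => y v Ayv; rewrite -diff invmapK.
by apply: xu; exists v.
Qed.

End StronglyMonotone.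

(** * Resolvent formulas *)

Section Resolvents.
Context {R : realType} {H G : hilbertType R}.
Variables (B : H -> set H) (M : {linear G -> H}) (U : {linear G -> G}).

Let Ms : H -> G := adjoint M.
Let UMBM : G -> set G := U%:op :o: Ms%:op :o: B :o: M%:op.
Let MUM : H -> H := M \o U \o Ms.

Lemma opinv_addE w u : opinv (MUM%:op :+: opinv B) w u <-> B (w - MUM u) u.
Proof.
split=> [[_ -> [b Bb <-]]|Bwu]; first by rewrite addrC addKr.
by exists (MUM u) => //; exists (w - MUM u) => //; rewrite addrC subrK.
Qed.

Lemma resolventE x y : resolvent UMBM x y <->
  exists2 u, B (M y) u & x = y + U (Ms u).
Proof.
split=> [[_ -> [_ [_ -> [u Bu [_ -> ->]]] <-]]|[u Bu ->]]; first by exists u.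
exists y => //; exists (U (Ms u)) => //; exists (M y) => //.
by exists u => //; exists (Ms u).
Qed.

(** The duality behind all the formulas: [y = x - U M^* u] is substituted in
    [u \in B (M y)], which becomes [M x \in M U M^* u + B^-1 u]. *)
Lemma resolvent_dualE x y : resolvent UMBM x y <->
  exists2 u, B (M x - MUM u) u & y = x - U (Ms u).
Proof.
rewrite resolventE; split=> [[u Bu ->]|[u Bu ->]]; exists u.
- by rewrite linearD /MUM /= addrK.
- by rewrite addrK.
- by rewrite linearB.
- by rewrite subrK.
Qed.

Lemma resolvent_dual : resolvent UMBM =
  (@idfun G)%:op :-: U%:op :o: Ms%:op :o: opinv (MUM%:op :+: opinv B) :o: M%:op.
Proof.
apply/funext => x; apply/seteqP; split=> y.
  move=> /resolvent_dualE[u Bu ->].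
  exists x => //; exists (U (Ms u)) => //; exists (M x) => //.
  by exists u; [exact/opinv_addE | exists (Ms u)].
case=> _ -> [_ [_ -> [u /opinv_addE Bu [_ -> ->]]] <-].
by apply/resolvent_dualE; exists u.
Qed.

(** Any [P] whose values solve [M U M^* w = M (S z)] can replace the
    Moore-Penrose inverse: the warped resolvent sees [w] through [M U M^* w]
    only, and [M (S z) = M x] when [S z = x]. *)
Lemma resolvent_warped (S : G -> G) (P : G -> set H) :
  (forall x, exists z, S z = x) -> (forall z, P z !=set0) ->
  (forall z w, P z w -> MUM w = M (S z)) ->
  resolvent UMBM =
    (@idfun G)%:op :-: U%:op :o: Ms%:op :o: warped_resolvent MUM (opinv B)
      :o: P :o: opinv S%:op.
Proof.
move=> S_surj P_neq0 MUMP; apply/funext => x; apply/seteqP; split=> y.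
  move=> /resolvent_dualE[u Bu ->].
  have [z Sz] := S_surj x; have [w Pw] := P_neq0 z.
  exists x => //; exists (U (Ms u)) => //; exists z => //; exists w => //.
  exists u; last by exists (Ms u).
  by exists (MUM w) => //; apply/opinv_addE; rewrite (MUMP z w Pw) Sz.
case=> _ -> [_ [z /= xSz [w Pw [u [_ -> /opinv_addE Bu] [_ -> ->]]]] <-].
apply/resolvent_dualE; exists u => //=.
by rewrite xSz -(MUMP z w Pw).
Qed.

Section BijectiveMUM.
Hypothesis M_bounded : bounded_near M (nbhs (0 : G)).
Variable L : H -> H.
Hypothesis MUMK : cancel MUM L.
Hypothesis LK : cancel L MUM.

Let UMsD u v : U (Ms (u + v)) = U (Ms u) + U (Ms v).
Proof.
by have := adjoint_linear M_bounded 1 u v; rewrite !scale1r /Ms => ->;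
  rewrite linearD.
Qed.

Let MUMD u v : MUM (u + v) = MUM u + MUM v.
Proof. by rewrite /MUM /= -/Ms UMsD linearD. Qed.

(** [w \in u + MUM^-1 B^-1 u] is [MUM (w - u) \in B^-1 u], and [MUM w = M x]. *)
Lemma resolvent_inv : resolvent UMBM =
  (@idfun G)%:op :-: U%:op :o: Ms%:op
     :o: resolvent (opinv MUM%:op :o: opinv B) :o: opinv MUM%:op :o: M%:op.
Proof.
apply/funext => x; apply/seteqP; split=> y.
  move=> /resolvent_dualE[u Bu ->].
  exists x => //; exists (U (Ms u)) => //; exists (M x) => //.
  exists (L (M x)); first by rewrite /opinv /op_of /= LK.
  exists u; last by exists (Ms u).
  exists u => //; exists (L (M x) - u); last by rewrite addrC subrK.
  exists (M x - MUM u) => //; rewrite /opinv /op_of /=.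
  by apply/eqP; rewrite subr_eq -MUMD subrK LK.
case=> _ -> [_ [_ -> [w Mxw [u [_ -> [v [b Bb bv] uv]] [_ -> ->]]]] <-].
apply/resolvent_dualE; exists u => //.
have -> : M x - MUM u = MUM v; last by rewrite -bv.
by rewrite Mxw -uv MUMD addrC addKr.
Qed.

(** If [x = y + U M^* u] with [u \in B (M y)], then applying [M] shows that
    [M y] belongs to the resolvent of [MUM B] at [M x], and that
    [L (M x) = L (M y) + u]. Hence [y] is the sum of [U M^* L (M y)] and of
    [x - U M^* L (M x)], the projection of [x] on the kernel of [M]. *)
Lemma resolvent_proj (P : G -> set G) :
  (forall x, P x = [set x - U (Ms (L (M x)))]) ->
  resolvent UMBM =
    P :+: U%:op :o: Ms%:op :o: opinv MUM%:op :o: resolvent (MUM%:op :o: B)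
      :o: M%:op.
Proof.
move=> PE; apply/funext => x; apply/seteqP; split=> y; rewrite /opadd PE.
  move=> /resolventE[u Bu xE].
  have MxE : M x = M y + MUM u by rewrite xE linearD.
  have LMx : L (M x) = L (M y) + u by rewrite MxE -{1}(LK (M y)) -MUMD MUMK.
  exists (x - U (Ms (L (M x)))) => //; exists (U (Ms (L (M y)))).
    exists (M x) => //; exists (M y).
      by exists (M y) => //; exists (MUM u); first by exists u.
    exists (L (M y)); first by rewrite /opinv /op_of /= LK.
    by exists (Ms (L (M y))).
  by rewrite LMx UMsD opprD addrA addrAC subrK xE addrK.
case=> _ -> [_ [_ -> [v [_ -> [_ [b Bb ->] vE]] [w /= vw [_ -> ->]]]] <-].
have LMx : L (M x) = w + b by rewrite -vE vw -MUMD MUMK.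
apply/resolvent_dualE; exists b; first by rewrite -vE addrK.
by rewrite LMx UMsD opprD addrA addrAC subrK.
Qed.

End BijectiveMUM.
End Resolvents.

(** * The operator M U M^* *)

Section CompositeOperator.
Context {R : realType} {H G : hilbertType R}.
Variables (M : {linear G -> H}) (U : {linear G -> G}) (mu : R).
Hypothesis M_bounded : bounded_near M (nbhs (0 : G)).
Hypothesis U_bounded : bounded_near U (nbhs (0 : G)).
Hypothesis U_self_adjoint : self_adjoint U.
Hypothesis mu_gt0 : 0 < mu.
Hypothesis U_strong : strongly_monotone_op mu inner U%:op.

Let Ms : H -> G := adjoint M.
Let MUM : H -> H := M \o U \o Ms.
Let Ui : G -> G := invmap U.

Lemma MUM_linear : linear MUM.
Proof.
move=> a u v; rewrite /MUM /= /Ms.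
by rewrite (adjoint_linear M_bounded a u v) !linearP.
Qed.

(** [inner h (M U M^* h) = inner (M^* h) (U (M^* h))]. *)
Lemma inner_MUM_ge h : mu * `|Ms h| ^+ 2 <= inner h (MUM h).
Proof.
rewrite dotC -(adjointE M_bounded) dotC.
exact: (strongly_monotone_coercive U_strong).
Qed.

Lemma MUM_ker h : MUM h = 0 -> Ms h = 0.
Proof.
move=> h0; have := inner_MUM_ge h; rewrite h0 dot0r pmulr_rle0 // norm_sqr.
exact: dot_eq0.
Qed.

Lemma MUM_inj_range h : range M h -> MUM h = 0 -> h = 0.
Proof. by move=> Mh /MUM_ker; exact: adjoint_inj_range. Qed.

(** On a closed range, [M^*] is bounded below, hence [M U M^*] is coercive
    there. *)
Lemma MUM_surj_range : closed (range M) ->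
  forall b, range M b -> exists2 h, range M h & MUM h = b.
Proof.
move=> Mc; have [K K0 MK] := adjoint_bounded_below M_bounded Mc.
have [k1 k10 Mk] := bounded_linear_le M_bounded.
have [k2 k20 Uk] := bounded_linear_le U_bounded.
have [k3 k30 Msk] := adjoint_le M_bounded.
apply: (lax_milgram (k := k1 * (k2 * k3)) (alpha := mu / K ^+ 2)
  (linear_subspace_range M) Mc MUM_linear).
- by rewrite divr_gt0 // exprn_gt0.
- by move=> h _; exists (U (Ms h)).
- move=> h _; rewrite /MUM /= -!mulrA.
  apply: (le_trans (Mk _)); rewrite ler_pM2l //.
  by apply: (le_trans (Uk _)); rewrite ler_pM2l.
- move=> h Mh; apply: le_trans (inner_MUM_ge h).
  rewrite mulrAC ler_pdivrMr ?exprn_gt0 // -mulrA ler_pM2l //.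
  by rewrite mulrC -exprMn ler_sqr ?nnegrE ?mulr_ge0 ?(ltW K0) //; exact: MK.
Qed.

(** A common value gives [p \in B^-1 x] and [q \in B^-1 y] with
    [p - q = - MUM (x - y)]; monotonicity of [B] then forces
    [inner (x - y) (MUM (x - y)) <= 0]. *)
Lemma opinjective_MUM_range (B : H -> set H) : monotone_op inner B ->
  opinjective (oprestrict (MUM%:op :+: opinv B) (range M)).
Proof.
move=> Bmono x y [w [[Mx [_ -> [p Bp pE]]] [My [_ -> [q Bq qE]]]]].
have Mxy : range M (x - y).
  exact: linear_subspaceB (linear_subspace_range M) Mx My.
apply/subr0_eq; apply: (adjoint_inj_range M_bounded Mxy).
have pq : p - q = - MUM (x - y).
  rewrite (zmod_morphism_linear MUM_linear) opprB.
  have -> : p = w - MUM x by rewrite -pE addrC addKr.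
  have -> : q = w - MUM y by rewrite -qE addrC addKr.
  by rewrite opprB addrC addrA subrK.
have := Bmono _ _ _ _ Bp Bq; rewrite pq dotNl dotC oppr_ge0 => le0.
have := le_trans (inner_MUM_ge _) le0.
by rewrite pmulr_rle0 // norm_sqr => /dot_eq0.
Qed.

(** The normal equation of [S M^*] at [z] reads [M S S M^* w = M S z]. *)
Lemma moore_penrose_sqrt (S : G -> G) : is_positive_sqrt U S ->
  forall z, moore_penrose (S \o Ms) z =
  [set w | MUM w = M (S z) /\ forall w', MUM w' = M (S z) -> `|w| <= `|w'|].
Proof.
move=> [Sl Sb Ssa _ SS] z.
pose S' : {linear G -> G} := HB.pack S (GRing.isLinear.Build _ _ _ _ S Sl).
have Ss x y : inner x (S y) = inner (S x) y by exact: (self_adjointE (U := S')).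
have -> : MUM = M \o S \o (S \o Ms).
  by apply/funext => h; rewrite /MUM /= -SS.
rewrite /moore_penrose (adjoint_unique (N := M \o S)) // => x y.
by rewrite /= -Ss dotC -(adjointE M_bounded) dotC.
Qed.

(** The solution that lies in the range of [M] has minimal norm: it is
    orthogonal to the kernel of [M^*], which contains the difference of any two
    solutions. *)
Lemma moore_penrose_neq0 (S : G -> G) : is_positive_sqrt U S ->
  closed (range M) -> forall z, moore_penrose (S \o Ms) z !=set0.
Proof.
move=> USqrt Mc z; rewrite (moore_penrose_sqrt USqrt).
have [|w [a _ aw] MUMw] := MUM_surj_range Mc (b := M (S z)); first by exists (S z).
exists w; split=> // w' MUMw'.
have Mw : Ms (w' - w) = 0.
  apply: MUM_ker; rewrite (zmod_morphism_linear MUM_linear).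
  by rewrite MUMw MUMw' subrr.
have ow : inner w (w' - w) = 0.
  by rewrite -aw -(adjointE M_bounded) -/Ms aw Mw dot0r.
rewrite -ler_sqr ?nnegrE // !norm_sqr.
have := dot_ge0 inner (w' - w); move: ow; rewrite !dotE (dotC _ w' w); lra.
Qed.

(** [x - p = U M^* w] is orthogonal to the kernel of [M] in the product of
    [U^-1], since [inner q (M^* w) = inner (M q) w]. *)
Lemma vproj_ker (L : H -> H) : cancel L MUM ->
  forall x, vproj Ui (M @^-1` [set 0]) x = [set x - U (Ms (L (M x)))].
Proof.
move=> LK x; set w := L (M x); set p := x - U (Ms w).
have [[d dE] _] := invmap_hilbert U_bounded U_self_adjoint mu_gt0 U_strong.
have Mp : M p = 0 by rewrite /p linearB -[M (U _)]/(MUM w) LK subrr.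
have pythagoras q : M q = 0 ->
    d (x - q) (x - q) = d (x - p) (x - p) + d (p - q) (p - q).
  move=> Mq; have xpE : x - p = U (Ms w) by rewrite /p opprB addrC subrK.
  have o : d (p - q) (x - p) = 0.
    rewrite -dE /vinner xpE (invmap_mapK U_bounded mu_gt0 U_strong).
    by rewrite (adjointE M_bounded) linearB Mp Mq subrr dot0l.
  have -> : x - q = (x - p) + (p - q) by rewrite addrA subrK.
  exact: hnormDd (etrans (dotC d _ _) o).
rewrite /vproj /vnorm; apply/seteqP; split=> q /=.
  move=> [Mq /(_ p Mp)]; rewrite !dE ler_sqrt ?dot_ge0 //.
  rewrite (pythagoras q) // gerDl => /dot_eq0/subr0_eq -> //.
move=> ->; split=> // q' Mq'; rewrite !dE ler_wsqrtr // (pythagoras q') //.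
by rewrite lerDl dot_ge0.
Qed.

End CompositeOperator.

(** * The resolvent of U M^* B M *)

Theorem theorem3p1 (R : realType) (H G : hilbertType R)
    (B : H -> set H) (M : {linear G -> H}) (U : {linear G -> G}) (mu : R)
    (B_max : maximally_monotone inner B)
    (M_bounded : bounded_near M (nbhs (0 : G)))
    (MBM_max : maximally_monotone inner ((adjoint M)%:op :o: B :o: M%:op))
    (U_bounded : bounded_near U (nbhs (0 : G)))
    (U_self_adjoint : self_adjoint U)
    (mu_gt0 : 0 < mu)
    (U_strong : strongly_monotone_op mu inner U%:op) :
  let Ms : H -> G := adjoint M in
  let UMBM : G -> set G := U%:op :o: Ms%:op :o: B :o: M%:op in
  let MUM : H -> H := M \o U \o Ms in
  let Ui : G -> G := invmap U in
  let Id : G -> set G := (@idfun G)%:op in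
  [/\ hilbert_product (vinner Ui),
      maximally_monotone (vinner Ui) UMBM &
  [/\ (* (i) *)
      range M `<=` opdom (opinv (MUM%:op :+: opinv B)) /\
      resolvent UMBM =
        Id :-: U%:op :o: Ms%:op :o: opinv (MUM%:op :+: opinv B) :o: M%:op,
      (* (ii) *)
      range MUM `<=` opran (MUM%:op :+: opinv B),
      (* (iii) *)
      opinjective (oprestrict (MUM%:op :+: opinv B) (range M)),
      (* (iv) *)
      closed (range M) ->
      resolvent UMBM =
        Id :-: U%:op :o: Ms%:op :o: warped_resolvent MUM (opinv B)
                 :o: moore_penrose (sqrt_op U \o Ms) :o: opinv (sqrt_op U)%:op &
      (* (v) *)
      range M = [set: H] ->
      resolvent UMBM =
        Id :-: U%:op :o: Ms%:op :o: resolvent (opinv MUM%:op :o: opinv B)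
                 :o: opinv MUM%:op :o: M%:op /\
      resolvent UMBM =
        vproj Ui (M @^-1` [set 0])
        :+: U%:op :o: Ms%:op :o: opinv MUM%:op
              :o: resolvent (MUM%:op :o: B) :o: M%:op]].
Proof.
move=> Ms UMBM MUM Ui Id.
have UMBME : UMBM = U%:op :o: (Ms%:op :o: B :o: M%:op).
  by apply/funext => x; apply/seteqP; split=> u;
    [move=> [v Mv [w Bw [z Mz Uz]]]; exists z => //; exists v => //; exists w
    |move=> [z [v Mv [w Bw Mz]] Uz]; exists v => //; exists w => //; exists z].
have hilb : hilbert_product (vinner Ui) by exact: invmap_hilbert U_strong.
have UMBM_max : maximally_monotone (vinner Ui) UMBM.
  rewrite UMBME.
  exact: (maximally_monotone_comp U_bounded mu_gt0 U_strong MBM_max).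
have resolvent_total x : exists y, resolvent UMBM x y.
  have [y [v [Av ->]]] := minty hilb UMBM_max x.
  by exists y, y => //; exists v.
have dom_range : range M `<=` opdom (opinv (MUM%:op :+: opinv B)).
  move=> _ [x _ <-]; have [y] := resolvent_total x.
  by move=> /resolvent_dualE[u Bu _]; exists u; exact/opinv_addE.
split=> //; split.
- by split; [exact: dom_range | exact: resolvent_dual].
- by move=> _ [h _ <-]; apply: dom_range; exists (U (Ms h)).
- exact: (opinjective_MUM_range M_bounded mu_gt0 U_strong B_max.1).
- move=> M_closed.
  have sqrtU : is_positive_sqrt U (sqrt_op U).
    rewrite /sqrt_op; case: xgetP => [S -> //|no_sqrt].
    have [S US] := positive_sqrt_exists U_bounded
      (self_adjointE U_bounded U_self_adjoint) mu_gt0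
      (strongly_monotone_coercive U_strong).
    by case: (no_sqrt S).
  apply: resolvent_warped => [x|z|z w].
  + have [_ _ _ _ SS] := sqrtU.
    have [z <-] := strongly_monotone_surj U_bounded mu_gt0 U_strong x.
    by exists (sqrt_op U z); rewrite -[in RHS]SS.
  + exact: (moore_penrose_neq0 M_bounded U_bounded mu_gt0 U_strong sqrtU
      M_closed z).
  + by rewrite (moore_penrose_sqrt M_bounded sqrtU) => -[].
- move=> M_onto.
  have M_closed : closed (range M) by rewrite M_onto; exact: closedT.
  have MUM_surj h : exists h', MUM h' = h.
    by have [|h' _ <-] := MUM_surj_range M_bounded U_bounded mu_gt0 U_strong
         M_closed (b := h); [rewrite M_onto | exists h'].
  have [L LK] := choice MUM_surj.
  have MUMK : cancel MUM L.
    move=> h; apply/subr0_eq.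
    apply: (MUM_inj_range M_bounded mu_gt0 U_strong); first by rewrite M_onto.
    by rewrite (zmod_morphism_linear (MUM_linear U M_bounded)) [X in X - _]LK subrr.
  split; first exact: (resolvent_inv B M_bounded LK).
  apply: (resolvent_proj B M_bounded MUMK LK) => x.
  exact: (vproj_ker M_bounded U_bounded U_self_adjoint mu_gt0 U_strong LK).
Qed.
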